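(* Let $\mathcal J:L_2(-1,1)\to[0,+\infty]$ be given by $$\mathcal J(u)=\begin{cases}\int_{-1}^1|Du| & \text{if } u\in BV[-1,1],\ u(-1)=\tfrac12,\ u(1)=\tfrac12,\\ +\infty&\text{otherwise.}\end{cases}$$ Then the function $x\mapsto\frac12x^2$ does not belong to $D(\partial\mathcal J)$.
   Context: $\int_{-1}^1|Du|$ is the total variation of the measure $Du$, with $BV$ considered over the closed interval $[-1,1]$ (jumps between interior traces and the prescribed boundary values are counted). The subdifferential: $w\in\partial\mathcal J(u)$ iff $w\in L_2(-1,1)$ and $\mathcal J(u+\phi)-\mathcal J(u)\ge(w,\phi)_{L_2(-1,1)}$ for all $\phi\in L_2(-1,1)$. $D(\partial\mathcal J)$ is the set of $u$ (with $\mathcal J(u)<\infty$) such that $\partial\mathcal J(u)\ne\emptyset$. *)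

(* Defs.v *)
From HB Require Import structures.
From mathcomp Require Import all_boot all_order all_algebra.
From mathcomp Require Import lra.
From mathcomp Require Import all_classical all_reals all_analysis.
From mathcomp Require Import ess_sup_inf measurable_realfun.
Set Implicit Arguments.
Unset Strict Implicit.
Unset Printing Implicit Defensive.
Import Order.TTheory GRing.Theory Num.Theory.
Import numFieldNormedType.Exports.
Local Open Scope classical_set_scope.
Local Open Scope ring_scope.

Lemma measurable_itv11 (R : realType) :
  measurable (`]-1, 1[%classic : set (measurableTypeR R)).
Proof. exact: measurable_itv. Qed.

(* Lebesgue measure on (-1, 1), seen as a measure on the whole line that
   vanishes outside (-1, 1). *)
Definition leb11 (R : realType) : {measure set (measurableTypeR R) -> \bar R} :=
  mrestr (@lebesgue_measure R) (@measurable_itv11 R).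

(* Elements are representatives, that is, measurable functions on the line;
   their values outside (-1, 1) play no role in what follows. *)
Definition L2 (R : realType) := LfunType (@leb11 R) (lee1n 2).

Definition L2inner (R : realType) (f g : L2 R) : R :=
  \int[@leb11 R]_x (f x * g x).

Definition subdifferential (R : realType) (F : L2 R -> \bar R) (u : L2 R) :
    set (L2 R) :=
  [set w | forall phi : L2 R, ((L2inner w phi)%:E <= F (u + phi)%R - F u)%E].

Definition dom_subdifferential (R : realType) (F : L2 R -> \bar R) :
    set (L2 R) :=
  [set u | (F u < +oo)%E /\ subdifferential F u !=set0].

Section charge_integral.
Context d (T : measurableType d) (R : realType).
Variable nu : {charge set T -> \bar R}.

(* The Jordan decomposition of nu does not depend on the Hahn decomposition
   chosen here. *)
Definition hahn_pos : set T := projT1 (cid (Hahn_decomposition nu)).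
Definition hahn_neg : set T :=
  projT1 (cid (projT2 (cid (Hahn_decomposition nu)))).
Definition hahn_posneg : hahn_decomposition nu hahn_pos hahn_neg :=
  projT2 (cid (projT2 (cid (Hahn_decomposition nu)))).

Definition charge_integral (f : T -> R) : R :=
  \int[jordan_pos hahn_posneg]_x f x - \int[jordan_neg hahn_posneg]_x f x.

Definition total_variation_measure : set T -> \bar R :=
  charge_variation hahn_posneg.

End charge_integral.

Definition C1c (R : realType) : set (R -> R) :=
  [set phi : R -> R | [/\ forall x : R, derivable phi x 1,
                 continuous (derive1 phi)
               & compact (closure [set x | phi x != 0])]].

(* u on (-1, 1), with the constant values a on the left and b on the right. *)
Definition extend11 (R : realType) (a b : R) (u : R -> R) (x : R) : R :=
  if x <= -1 then a else if 1 <= x then b else u x.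

(* nu is the distributional derivative of g on the line. *)
Definition is_distr_derivative (R : realType) (g : R -> R)
    (nu : {charge set (measurableTypeR R) -> \bar R}) : Prop :=
  forall phi, @C1c R phi ->
    charge_integral nu phi = - \int[@lebesgue_measure R]_x (g x * derive1 phi x).

(* The measure Du over [-1, 1] of a function u with boundary values u(-1) = a
   and u(1) = b is the distributional derivative of extend11 a b u: its atoms
   at -1 and 1 are the jumps between a, b and the interior traces of u. *)
Definition is_Du (R : realType) (a b : R) (u : R -> R) :=
  is_distr_derivative (extend11 a b u).

(* u belongs to BV[-1, 1] with u(-1) = a and u(1) = b. *)
Definition BV11 (R : realType) (a b : R) (u : L2 R) : Prop :=
  exists nu, is_Du a b u nu.

(* Du is unique when it exists, so that the infimum below ranges over exactly
   one value. *)
Definition Du_variation (R : realType) (a b : R) (u : L2 R) : \bar R :=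
  ereal_inf [set total_variation_measure nu `[-1, 1]%classic
            | nu in [set nu | is_Du a b u nu]].

Definition J (R : realType) (u : L2 R) : \bar R :=
  if `[< BV11 (1 / 2) (1 / 2) u >] then Du_variation (1 / 2) (1 / 2) u
  else +oo%E.

Definition half_sq_fun (R : realType) (x : R) : R := 1 / 2 * x ^+ 2.

Lemma half_sq_Lfun (R : realType) : @half_sq_fun R \in Lfun (@leb11 R) 2%:E.
Proof.
have mf : measurable_fun [set: measurableTypeR R] (@half_sq_fun R).
  by apply: measurable_funM => //; exact: measurable_funX.
have fin : @leb11 R [set: _] \is a fin_num.
  rewrite /leb11/= /mrestr setTI lebesgue_measure_itv/= lte_fin.
  by rewrite (@lt_trans _ _ 0) ?ltrN10.
have ley : (1 <= +oo :> \bar R)%E by rewrite leey.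
apply: (Lfun_subset (lee1n 2) ley fin (leey _)).
rewrite inE; apply/andP; split; rewrite inE//= /finite_norm unlock /Lnorm.
case: ifPn => // _.
apply: (@le_lt_trans _ _ 1%E); last exact: ltry.
apply/ess_supP; exists (~` `]-1, 1[%classic); split.
- by apply: measurableC; exact: measurable_itv11.
- by rewrite /leb11/= /mrestr setICl measure0.
- move=> x /=; apply: contra_not; rewrite /= in_itv/= => /andP[x0 x1].
  have x21 : x ^+ 2 <= 1.
    by rewrite -real_normK ?num_real// expr_le1// ler_norml !ltW.
  have x20 : 0 <= x ^+ 2 := sqr_ge0 x.
  by rewrite lee_fin /half_sq_fun ler_norml; apply/andP; split; lra.
Qed.

Definition half_sq (R : realType) : L2 R :=
  Lfun_Sub (lee1n 2) (@half_sq_Lfun R).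

(* Main.v *)
Require Import Defs.
From mathcomp Require Import all_boot all_order all_algebra.
From mathcomp Require Import ring lra.
From mathcomp Require Import all_classical all_reals all_analysis.
From mathcomp Require Import measurable_realfun.
Set Implicit Arguments.
Unset Strict Implicit.
Unset Printing Implicit Defensive.
Import Order.TTheory GRing.Theory Num.Theory.
Import numFieldNormedType.Exports.
Local Open Scope classical_set_scope.
Local Open Scope ring_scope.

(** Replacing x^2/2 by v_e := max(e^2/2, x^2/2) lowers the total variation
    from 1 to 1 - e^2, whereas v_e - x^2/2 lies between 0 and e^2/2 and
    vanishes outside [-e, e], so that its inner product with a fixed
    w in L^2 is O(e^2 sqrt(e)). A subgradient w would therefore give
    e^2 <= C e^2 sqrt(e) for all small e.

    The upper bound J(v_e) <= 1 - e^2 comes from the charge of density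
    x 1_{e < |x| < 1}; the lower bound J(x^2/2) >= 1 - 2d comes from
    testing Du against a C^1 function bounded by 1 and equal to sgn x for
    d <= |x| <= 1 - d. *)

(** * Lower bounds on the total variation of a charge by testing *)

Section charge_bounds.
Context d (T : measurableType d) (R : realType).
Variable nu : {charge set T -> \bar R}.

Let mpos : measurable (hahn_pos nu).
Proof. by have [[]] := hahn_posneg nu. Qed.

Let mneg : measurable (hahn_neg nu).
Proof. by have [_ []] := hahn_posneg nu. Qed.

Lemma jordan_posE_hahn A : measurable A ->
  jordan_pos (hahn_posneg nu) A = nu (A `&` hahn_pos nu).
Proof. by move=> mA; rewrite jordan_posE cjordan_posE /crestr0 mem_set. Qed.

Lemma jordan_negE_hahn A : measurable A ->
  jordan_neg (hahn_posneg nu) A = (- nu (A `&` hahn_neg nu))%E.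
Proof. by move=> mA; rewrite jordan_negE cjordan_negE /crestr0 mem_set. Qed.

(** Since [f] is dominated by the indicator of [A], its integral against each Jordan part [m] has
    absolute value at most [m A]; the variation is the sum of these two masses. *)
Lemma charge_integral_le (A : set T) (f : T -> R) : measurable A ->
    measurable_fun [set: T] f -> (forall x, `|f x| <= \1_A x) ->
  ((charge_integral nu f)%:E <= total_variation_measure nu A)%E.
Proof.
move=> mA mf f1.
have bound (m : {finite_measure set T -> \bar R}) :
    (`|\int[m]_x f x|%:E <= m A)%E.
  have fi : m.-integrable [set: T] (EFin \o f).
    apply: (@le_integrable _ _ _ m [set: T] measurableT _ (EFin \o \1_A)) => //.
    - exact/measurable_EFinP.
    - by move=> x _ /=; rewrite lee_fin (le_trans (f1 x))// ler_norm.
    - by apply: integrable_indic => //; rewrite fin_num_fun_lty//;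
        exact: fin_num_measure.
  rewrite EFin_normr_Rintegral//.
  apply: (le_trans (le_abse_integral _ _ _)) => //.
    by case/integrableP : fi.
  have -> : m A = (\int[m]_x (\1_A x)%:E)%E by rewrite integral_indic// setIT.
  apply: ge0_le_integral => //.
  - by apply: measurableT_comp => //; exact/measurable_EFinP.
  - by apply/measurable_EFinP; exact: measurable_indic.
  - by move=> x _ /=; rewrite lee_fin.
rewrite /charge_integral /total_variation_measure /charge_variation.
have bp := bound (jordan_pos (hahn_posneg nu)).
have bn := bound (jordan_neg (hahn_posneg nu)).
rewrite EFinB; apply: leeD.
  by apply: le_trans bp; rewrite lee_fin ler_norm.
by apply: le_trans bn; rewrite -EFinN lee_fin -normrN ler_norm.
Qed.

End charge_bounds.

(** * Charges given by an integrable density *)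

Section density.
Context d (T : measurableType d) (R : realType).
Variable mu : {sigma_finite_measure set T -> \bar R}.

(** The Radon-Nikodym derivative of [nu] has the same integral as [h] over every measurable set,
    hence equals it almost everywhere; the rest is a change of variables. *)
Lemma integral_density (nu : {finite_measure set T -> \bar R}) (h f : T -> R) :
    mu.-integrable [set: T] (EFin \o h) ->
    (forall A, measurable A -> nu A = \int[mu]_(x in A) (h x)%:E)%E ->
    nu.-integrable [set: T] (EFin \o f) ->
  \int[nu]_x f x = \int[mu]_x (f x * h x).
Proof.
move=> ih nuE iff.
have numu : nu `<< mu.
  apply/null_content_dominatesP => A mA A0.
  by rewrite nuE// null_set_integral//;
    exact: measurable_funTS (measurable_int _ ih).
have mff := measurable_int _ iff; have mh := measurable_int _ ih.
congr fine; rewrite -(Radon_Nikodym_change_of_variables numu)//.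
apply: ae_eq_integral => //.
- by apply: emeasurable_funM => //; apply: measurable_int;
    apply: Radon_Nikodym_integrable.
- by under eq_fun do rewrite EFinM; exact: emeasurable_funM.
under [X in ae_eq _ _ _ X]eq_fun do rewrite EFinM.
apply: ae_eqe_mul2l; apply: integral_ae_eq => //.
- exact: Radon_Nikodym_integrable.
- by move=> A _ mA; rewrite -Radon_Nikodym_integral//= /charge_of_finite_measure nuE.
Qed.

Section induced.
Variable h : T -> R.
Hypothesis ih : mu.-integrable [set: T] (EFin \o h).

Definition density_charge : {charge set T -> \bar R} := induced_charge ih.

Let mpos : measurable (hahn_pos density_charge).
Proof. by have [[]] := hahn_posneg density_charge. Qed.

Let mneg : measurable (hahn_neg density_charge).
Proof. by have [_ []] := hahn_posneg density_charge. Qed.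

(** For a Hahn decomposition [P], [N], the Jordan parts have densities [h] on [P] and [- h] on [N],
    extended by zero. A bounded [f] is integrable for both parts, so [integral_density] applies to
    each. *)
Lemma charge_integral_density (f : T -> R) (M : R) :
    measurable_fun [set: T] f -> (forall x, `|f x| <= M) ->
  charge_integral density_charge f = \int[mu]_x (f x * h x).
Proof.
move=> mf fM.
have fi (m : {finite_measure set T -> \bar R}) :
    m.-integrable [set: T] (EFin \o f).
  apply: (@le_integrable _ _ _ m [set: T] measurableT _ (EFin \o cst M)) => //.
  - exact/measurable_EFinP.
  - by move=> x _ /=; rewrite lee_fin (le_trans (fM x))// ler_norm.
  - exact: finite_measure_integrable_cst.
have ihr (D : set T) : measurable D ->
    mu.-integrable [set: T] (EFin \o (h \_ D)).
  move=> mD; rewrite -restrict_EFin; apply/integrable_restrict => //=.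
  by rewrite setTI; exact: integrableS ih.
have hE (D A : set T) : measurable D -> measurable A ->
    (density_charge (A `&` D) = \int[mu]_(x in A) ((h \_ D) x)%:E)%E.
  move=> mD mA; rewrite /density_charge /= /induced_charge integral_mkcondr.
  by apply: eq_integral => x _; rewrite restrict_EFin.
have nh := ihr _ mneg; have ph := ihr _ mpos.
rewrite /charge_integral (integral_density ph)//; last first.
  by move=> A mA; rewrite -hE//; exact: jordan_posE_hahn.
have nh' : mu.-integrable [set: T]
    (EFin \o (fun x => - (h \_ (hahn_neg density_charge)) x)).
  exact: integrableN nh.
rewrite (integral_density nh')//; last first.
  move=> A mA; rewrite [LHS](jordan_negE_hahn _ mA) hE//.
  rewrite -integralN//; apply: integrable_add_def => //.
  exact: integrableS nh.
have bmul g : mu.-integrable [set: T] (EFin \o g) ->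
    mu.-integrable [set: T] (EFin \o (fun x => f x * g x)).
  move=> gi; apply: (@le_integrable _ _ _ mu [set: T] measurableT _
    (fun x => M%:E * (EFin \o g) x)%E).
  - by apply/measurable_EFinP/measurable_funM => //;
      apply/measurable_EFinP; exact: measurable_int gi.
  - move=> x _ /=; rewrite lee_fin !normrM ler_wpM2r//.
    by rewrite (le_trans (fM x))// ler_norm.
  - exact: integrableZl.
rewrite -RintegralB//; [|exact: bmul|exact: bmul].
apply: eq_Rintegral => x _.
(* The Hahn sets partition the space, so at each point exactly one of the two restrictions
   contributes [h x]. *)
have [_ _ PN PN0] := hahn_posneg density_charge.
rewrite -mulrBr opprK; congr (_ * _).
rewrite /patch; have [xP|xP] := boolP (x \in hahn_pos density_charge);
  have [xN|xN] := boolP (x \in hahn_neg density_charge); rewrite ?addr0 ?add0r//.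
- have : set0 x by rewrite -PN0; split; exact: set_mem.
  by [].
- have : [set: T] x by [].
  by rewrite -PN => -[] /mem_set; [move: xP|move: xN] => /negP.
Qed.

(** Splitting [A] along the Hahn sets, each piece contributes at most the integral of the absolute
    value of [h] over it. *)
Lemma total_variation_density (A : set T) : measurable A ->
  (total_variation_measure density_charge A <= \int[mu]_(x in A) (`|h x|)%:E)%E.
Proof.
move=> mA; have mh := measurable_int _ ih.
have [_ _ PN PN0] := hahn_posneg density_charge.
rewrite /total_variation_measure /charge_variation /=.
rewrite jordan_posE_hahn// jordan_negE_hahn//.
rewrite -{3}(setIT A) -PN setIUr ge0_integral_setU//=; first last.
- by apply/disj_setPS; rewrite setIACA PN0 setI0.
- apply/measurable_funTS/measurable_EFinP; apply: measurableT_comp => //.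
  exact/measurable_EFinP.
- exact: measurableI.
- exact: measurableI.
have le1 (B : set T) : measurable B ->
    (`|density_charge B| <= \int[mu]_(x in B) (`|h x|)%:E)%E.
  by move=> mB; apply: le_abse_integral => //; exact: measurable_funTS.
apply: leeD.
  by apply: le_trans (le1 _ (measurableI _ _ mA mpos)); exact: lee_abs.
apply: le_trans (le1 _ (measurableI _ _ mA mneg)).
by rewrite -abseN; exact: lee_abs.
Qed.

End induced.
End density.

(** * Piecewise integration on half-open intervals *)

Section half_open_integrals.
Context (R : realType).
Notation mu := (@lebesgue_measure R).
Implicit Types (f p P : R -> R) (a b c v w : R).

(** Half-open intervals concatenate without overlap, and extension by zero puts every piece on the
    same domain, so gluing is mere addition. *)
Definition has_integral f a b v :=
  mu.-integrable [set: R] (EFin \o (f \_ `]a, b])) /\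
  \int[mu]_x (f \_ `]a, b]) x = v.

Lemma has_integral_cat f a b c v w : a <= b -> b <= c ->
  has_integral f a b v -> has_integral f b c w -> has_integral f a c (v + w).
Proof.
move=> ab bc [iab <-] [ibc <-].
have fE x : (f \_ `]a, c]) x = (f \_ `]a, b]) x + (f \_ `]b, c]) x.
  rewrite /patch !mem_setE !in_itv /=.
  case: (leP x b) => xb; rewrite ?andbT ?andbF /= ?addr0.
    by rewrite (le_trans xb bc) andbT.
  by rewrite (le_lt_trans ab xb) /= add0r.
split.
  have := integrableD measurableT iab ibc.
  by apply: eq_integrable => // x _; rewrite /= -EFinD fE.
by rewrite -RintegralD//; apply: eq_Rintegral => x _.
Qed.

(** Agreement with [p] is asked only on the half-open interval, so [f] may jump at [a]; that point
    is negligible, and the usual theorem for [P] on the closed interval concludes. *)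
Lemma has_integral_FTC f P p a b : a <= b ->
    (forall x : R, is_derive x 1 P (p x)) -> continuous p ->
    (forall x, a < x -> x <= b -> f x = p x) ->
  has_integral f a b (P b - P a).
Proof.
move=> ab dP cp fp.
have fpE : f \_ `]a, b] = p \_ `]a, b].
  apply/funext => x; rewrite /patch mem_setE in_itv /=.
  by case: ifPn => // /andP[ax xb]; rewrite fp.
have ip : mu.-integrable `]a, b] (EFin \o p).
  apply: (@integrableS _ _ _ mu `[a, b]) => //.
    exact: subset_itv_oc_cc.
  apply: continuous_compact_integrable; first exact: segment_compact.
  exact: continuous_subspaceT.
rewrite /has_integral fpE; split.
  rewrite -restrict_EFin; apply/integrable_restrict => //=.
  by rewrite setTI.
rewrite -Rintegral_mkcond Rintegral_itv_obnd_cbnd//.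
move: ab; rewrite le_eqVlt => /predU1P[->|ab].
  by rewrite set_itv1 Rintegral_set1 subrr.
rewrite /Rintegral (@continuous_FTC2 _ p P)//.
- exact: continuous_subspaceT.
- have cP : continuous P.
    by move=> x; apply/differentiable_continuous/derivable1_diffP; case: (dP x).
  split; first by move=> x _; case: (dP x).
  + exact/cvg_at_right_filter/cP.
  + exact/cvg_at_left_filter/cP.
- by move=> x _; rewrite derive1E; case: (dP x).
Qed.

End half_open_integrals.

(** * The density of the derivative of a truncated parabola *)

Section band.
Context (R : realType).
Notation mu := (@lebesgue_measure R).
Implicit Types (a b e x : R).

(** With [b = 1] and [0 <= a <= 1], this is almost everywhere the derivative of max(a^2/2, x^2/2)
    extended by 1/2 outside (-1, 1). The intervals are half-open to fit [has_integral]. *)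
Definition band a b x : R := x * (\1_`]- b, - a] x + \1_`]a, b] x).

Lemma measurable_band a b : measurable_fun [set: R] (band a b).
Proof.
by apply: measurable_funM => //; apply: measurable_funD => //;
  exact: measurable_indic.
Qed.

Lemma bandE a b x : 0 <= a -> band a b x =
  if (- b < x <= - a) || (a < x <= b) then x else 0.
Proof.
move=> a0; rewrite /band !indicE !mem_setE !in_itv /=.
case: (boolP (- b < x <= - a)) => [/andP[_ xa]|_] /=.
  have -> : (a < x) = false by apply: negbTE; rewrite -leNgt; lra.
  by rewrite addr0 mulr1.
by rewrite add0r; case: ifP => _; rewrite ?mulr1 ?mulr0.
Qed.

Lemma norm_band_le a b x : 0 <= a -> `|band a b x| <= b * \1_`]- b, b] x.
Proof.
move=> a0; rewrite bandE// indicE mem_setE in_itv /=.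
case: ifPn => [|_].
  move=> h; have -> : - b < x <= b by move: h => /orP[]/andP[h1 h2]; lra.
  by rewrite mulr1 ler_norml; move: h => /orP[]/andP[h1 h2]; lra.
by rewrite normr0; case: (boolP (- b < x <= b)) => h; rewrite ?mulr0 ?mulr1//; lra.
Qed.

Lemma integrable_bounded_support (f : R -> R) (M b : R) :
  measurable_fun [set: R] f -> (forall x, `|f x| <= M * \1_`]- b, b] x) ->
  mu.-integrable [set: R] (EFin \o f).
Proof.
move=> mf fM; apply: (@le_integrable _ _ _ mu [set: R] measurableT _
   (EFin \o (fun x => M * \1_`]- b, b] x))).
- exact/measurable_EFinP.
- by move=> x _ /=; rewrite lee_fin (le_trans (fM x))// ler_norm.
- exact: integrableZl (integrable_indic_itv _ _ _ _).
Qed.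

Lemma integral_norm_band a b : 0 <= a -> a <= b ->
  \int[mu]_x `|band a b x| = b ^+ 2 - a ^+ 2.
Proof.
move=> a0 ab.
pose f x := `|band a b x|.
(* The three pieces of the integrand are [c * x] with [c] equal to -1, 0 and 1. *)
have dsq (c x : R) : is_derive x 1 (fun y : R => c / 2 * y ^+ 2) (c * x).
  apply: is_derive_eq; rewrite /GRing.scale/= mulr1; lra.
have cl (c : R) : continuous (fun x : R => c * x).
  by move=> x; apply: cvgM; [exact: cvg_cst|exact: cvg_id].
have p1 : has_integral f (- b) (- a) ((-1) / 2 * (- a) ^+ 2 - (-1) / 2 * (- b) ^+ 2).
  apply: (has_integral_FTC _ (dsq (-1)) (cl (-1)) _); first lra.
  move=> x bx xa; rewrite /f bandE// bx xa /= ler0_norm; lra.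
have p2 : has_integral f (- a) a (0 / 2 * a ^+ 2 - 0 / 2 * (- a) ^+ 2).
  apply: (has_integral_FTC _ (dsq 0) (cl 0) _); first lra.
  move=> x bx xa; rewrite /f bandE// mul0r.
  case: ifPn; last by rewrite normr0.
  by move=> /orP[]/andP[h1 h2]; exfalso; lra.
have p3 : has_integral f a b (1 / 2 * b ^+ 2 - 1 / 2 * a ^+ 2).
  apply: (has_integral_FTC _ (dsq 1) (cl 1) _); first lra.
  move=> x bx xa; rewrite /f bandE// bx xa orbT ger0_norm; lra.
have := has_integral_cat _ _ (has_integral_cat _ _ p1 p2) p3.
case; try lra.
have -> : f \_ `]- b, b] = f.
  apply/funext => x; rewrite /patch mem_setE in_itv /=.
  case: ifPn => // h; rewrite /f bandE//.
  case: ifPn; last by rewrite normr0.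
  by move=> h2; exfalso; move: h => /negP; apply; move: h2 => /orP[]/andP[? ?]; lra.
move=> _ ->; lra.
Qed.

End band.

(** * Bounds and support of test functions *)

Section C1c_theory.
Context (R : realType).
Notation mu := (@lebesgue_measure R).
Implicit Type phi : R -> R.

Lemma C1c_support phi : @C1c R phi -> exists M : R,
  [/\ 1 <= M, forall x, `|phi x| <= M &
      forall x, M <= `|x| -> phi x = 0 /\ derive1 phi x = 0].
Proof.
move=> [dphi _ cK].
have cphi : continuous phi.
  by move=> x; apply/differentiable_continuous/derivable1_diffP.
have [M1 [M1r KM]] := compact_bounded cK.
have [M2 [M2r phiM]] := compact_bounded
  (continuous_compact (continuous_subspaceT cphi) cK).
pose m1 := `|M1| + 1; pose m2 := `|M2| + 1.
have M1m : M1 < m1 by rewrite /m1 ltr_pwDr// ler_norm.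
have M2m : M2 < m2 by rewrite /m2 ltr_pwDr// ler_norm.
have m1_ge : 1 <= m1 by rewrite /m1 lerDr.
have m2_ge : 1 <= m2 by rewrite /m2 lerDr.
have phi0 x : m1 < `|x| -> phi x = 0.
  move=> mx; apply/eqP/negPn/negP => px.
  have /KM /= : closure [set x | phi x != 0] x by exact: subset_closure.
  by move=> /(_ _ M1m); rewrite leNgt mx.
(* One constant bounds the values and the support. As [m2] is positive, [M <= |x|] gives the strict
   [m1 < |x|], an open condition: [phi] vanishes near [x], and so does its derivative at [x]. *)
exists (m1 + m2); split; first lra.
- move=> x; have [->|px] := eqVneq (phi x) 0; first by rewrite normr0; lra.
  have /phiM : (phi @` closure [set x | phi x != 0]) (phi x).
    by exists x => //; exact: subset_closure.
  move=> /(_ _ M2m) /=; lra.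
- move=> x mx; have mx1 : m1 < `|x| by lra.
  split; first exact: phi0.
  have near0 : \forall y \near x, phi y = (cst 0 : R -> R) y.
    have : \forall y \near x, m1 < `|y|.
      exact: (cvgr_gt _ (@norm_continuous R R x) _ mx1).
    by apply: filterS => y; exact: phi0.
  rewrite derive1E (near_eq_derive (1 : R) near0).
  exact: derive_cst.
Qed.

End C1c_theory.

(** * Integration by parts for the truncated parabola *)

Section level.
Context (R : realType).
Notation mu := (@lebesgue_measure R).

(** The competitor v_e; at [e = 0] it is x^2/2 itself, so one integration by parts serves both
    energy bounds. *)
Definition level (e x : R) : R := Num.max (1 / 2 * e ^+ 2) (1 / 2 * x ^+ 2).

(** The extended function is continuous and polynomial on each of the five intervals cut by -1, -e,
    e and 1. The boundary terms telescope, and those at the outer ends [- M] and [M] vanish with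
    [phi]. *)
Lemma integral_by_parts_level (e : R) (phi : R -> R) : 0 <= e -> e <= 1 ->
    C1c phi ->
  - (\int[mu]_x (extend11 (1 / 2) (1 / 2) (level e) x * derive1 phi x)) =
  \int[mu]_x (phi x * band e 1 x).
Proof.
move=> e0 e1 Cphi; have [M [M1 phiM phi0]] := C1c_support Cphi.
have [dphi cdphi _] := Cphi.
have cphi : continuous phi.
  by move=> x; apply/differentiable_continuous/derivable1_diffP.
set g := extend11 _ _ _.
(* On each piece this is the derivative of [g * phi]; the claim is that its integral is zero. *)
pose f x := g x * derive1 phi x + phi x * band e 1 x.
have dP (G : R -> R) (G' : R -> R) (x : R) : is_derive x 1 G (G' x) ->
    is_derive x 1 (fun y => G y * phi y) (G x * derive1 phi x + phi x * G' x).
  move=> dG; have dph : is_derive x 1 phi (derive1 phi x).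
    by rewrite derive1E; exact: derivableP.
  exact: is_deriveM.
have dcst (c x : R) : is_derive x 1 (fun y => c * phi y)
    (c * derive1 phi x + phi x * 0).
  exact: (dP (cst c) (cst 0)).
have ccst (c : R) : continuous (fun x => c * derive1 phi x + phi x * 0).
  move=> x; apply: cvgD; apply: cvgM; try exact: cvg_cst.
    exact: cdphi.
  exact: cphi.
have dsq (x : R) : is_derive x 1 (fun y => (1 / 2 * y ^+ 2) * phi y)
    ((1 / 2 * x ^+ 2) * derive1 phi x + phi x * x).
  apply: (dP (fun x => 1 / 2 * x ^+ 2) id).
  by apply: is_derive_eq; rewrite /GRing.scale/= mulr1; lra.
have csq : continuous (fun x : R => (1 / 2 * x ^+ 2) * derive1 phi x + phi x * x).
  move=> x; apply: cvgD; apply: cvgM.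
  - by apply: cvgM; [exact: cvg_cst|exact: exprn_continuous].
  - exact: cdphi.
  - exact: cphi.
  - exact: cvg_id.
have gE (x : R) : g x =
    if x <= -1 then 1 / 2 else if 1 <= x then 1 / 2 else level e x by [].
(* The endpoints -1 and 1 are included: the prescribed value 1/2 is that of x^2/2, so no jump arises
   there. *)
have gsq (x : R) : e <= `|x| -> `|x| <= 1 -> g x = 1 / 2 * x ^+ 2.
  move=> ex x1; rewrite gE; move: (x1); rewrite ler_norml => /andP[x1l x1r].
  case: ifPn => [x1'|_]; first by (have -> : x = -1 by lra); lra.
  case: ifPn => [x1'|_]; first by (have -> : x = 1 by lra); lra.
  have : e ^+ 2 <= x ^+ 2 by rewrite -(real_normK (num_real x)) ler_sqr ?nnegrE.
  by move=> ?; rewrite /level max_r//; lra.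
(* Meeting the constant extension forces [e = 1], where both values are 1/2. *)
have gflat (x : R) : - e <= x <= e -> g x = 1 / 2 * e ^+ 2.
  move=> xe; rewrite gE.
  have xx : x ^+ 2 <= e ^+ 2 by nra.
  case: ifPn => [x1'|_]; first by (have -> : e = 1 by lra); lra.
  case: ifPn => [x1'|_]; first by (have -> : e = 1 by lra); lra.
  rewrite /level max_l//; lra.
have p1 : has_integral f (- M) (- 1) (1 / 2 * phi (- 1) - 1 / 2 * phi (- M)).
  apply: (has_integral_FTC _ (dcst (1 / 2)) (ccst _) _); first lra.
  move=> x _ x1; rewrite /f gE x1 bandE//; case: ifPn => //.
  by move=> /orP[]/andP[? ?]; exfalso; lra.
have p2 : has_integral f (- 1) (- e)
    (1 / 2 * (- e) ^+ 2 * phi (- e) - 1 / 2 * (- 1) ^+ 2 * phi (- 1)).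
  apply: (has_integral_FTC _ dsq csq _); first lra.
  move=> x x1 xe; rewrite /f bandE// x1 xe /= gsq//.
    by rewrite ler0_norm; lra.
  by rewrite ler0_norm; lra.
have p3 : has_integral f (- e) e
    (1 / 2 * e ^+ 2 * phi e - 1 / 2 * e ^+ 2 * phi (- e)).
  apply: (has_integral_FTC _ (dcst (1 / 2 * e ^+ 2)) (ccst _) _); first lra.
  move=> x x1 xe; rewrite /f gflat ?(ltW x1)// bandE//; case: ifPn => //.
  by move=> /orP[]/andP[? ?]; exfalso; lra.
have p4 : has_integral f e 1
    (1 / 2 * 1 ^+ 2 * phi 1 - 1 / 2 * e ^+ 2 * phi e).
  apply: (has_integral_FTC _ dsq csq _); first lra.
  move=> x ex x1; rewrite /f bandE// ex x1 orbT gsq//.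
    by rewrite ger0_norm; lra.
  by rewrite ger0_norm; lra.
have p5 : has_integral f 1 M (1 / 2 * phi M - 1 / 2 * phi 1).
  apply: (has_integral_FTC _ (dcst (1 / 2)) (ccst _) _); first lra.
  move=> x x1 _; rewrite /f gE (ltW x1) ifF; last by apply/negbTE; lra.
  rewrite bandE//; case: ifPn => //.
  by move=> /orP[]/andP[? ?]; exfalso; lra.
have [] := has_integral_cat _ _ (has_integral_cat _ _ (has_integral_cat _ _
  (has_integral_cat _ _ p1 p2) p3) p4) p5; try lra.
have -> : f \_ `]- M, M] = f.
  apply/funext => x; rewrite /patch mem_setE in_itv /=.
  case: ifPn => // h; have [|p0 p0'] := phi0 x.
    rewrite leNgt; apply: contra h.
    by rewrite ltr_norml => /andP[-> /ltW].
  by rewrite /f p0 p0' mulr0 mul0r addr0.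
have [phiM0 _] : phi M = 0 /\ derive1 phi M = 0.
  by apply: phi0; rewrite ger0_norm; lra.
have [phiNM0 _] : phi (- M) = 0 /\ derive1 phi (- M) = 0.
  by apply: phi0; rewrite normrN ger0_norm; lra.
rewrite phiM0 phiNM0 => fi fint.
have bi : mu.-integrable [set: R] (EFin \o (fun x => phi x * band e 1 x)).
  apply: (@integrable_bounded_support _ _ M 1).
    apply: measurable_funM; last exact: measurable_band.
    exact: continuous_measurable_fun cphi.
  move=> x; rewrite normrM ler_pM//.
  by rewrite (le_trans (norm_band_le _ _ _))// mul1r.
have gi : \int[mu]_x (g x * derive1 phi x) =
    \int[mu]_x f x - \int[mu]_x (phi x * band e 1 x).
  by rewrite -RintegralB//; apply: eq_Rintegral => x _; rewrite /f addrK.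
rewrite gi fint sqrrN; lra.
Qed.

End level.

(** * Closure properties of continuously differentiable functions *)

Section C1_functions.
Context (R : realType).
Implicit Types (f g : R -> R) (x : R).

Definition C1 f := exists f' : R -> R,
  (forall x, is_derive x 1 f (f' x)) /\ continuous f'.

Lemma C1_continuous f : C1 f -> continuous f.
Proof.
move=> [f' [df _]] x.
by apply/differentiable_continuous/derivable1_diffP; case: (df x).
Qed.

Lemma C1B f g : C1 f -> C1 g -> C1 (fun x => f x - g x).
Proof.
move=> [f' [df cf]] [g' [dg cg]]; exists (fun x => f' x - g' x); split.
  by move=> x; exact: is_deriveB.
by move=> x; apply: cvgB; [exact: cf|exact: cg].
Qed.

Lemma C1M f g : C1 f -> C1 g -> C1 (fun x => f x * g x).
Proof.
move=> Cf Cg; have cf := C1_continuous Cf; have cg := C1_continuous Cg.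
case: Cf Cg => [f' [df cf']] [g' [dg cg']].
exists (fun x => f x * g' x + g x * f' x); split.
  by move=> x; exact: is_deriveM.
by move=> x; apply: cvgD; apply: cvgM; [exact: cf|exact: cg'|exact: cg|exact: cf'].
Qed.

Lemma C1V f : (forall x, f x != 0) -> C1 f -> C1 (fun x => (f x)^-1).
Proof.
move=> f0 Cf; have cf := C1_continuous Cf.
case: Cf => [f' [df cf']]; exists (fun x => - (f x) ^- 2 * f' x); split.
  by move=> x; exact: is_deriveV.
move=> x; apply: cvgM; last exact: cf'.
apply: cvgN; apply: cvgV; first by rewrite expf_neq0.
by apply: (@continuous_comp _ _ _ f (fun y => y ^+ 2));
  [exact: cf|exact: exprn_continuous].
Qed.

Lemma C1_comp f g : C1 f -> C1 g -> C1 (fun x => f (g x)).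
Proof.
move=> [f' [df cf]] Cg; have cg := C1_continuous Cg.
case: Cg => g' [dg cg']; exists (fun x => f' (g x) * g' x); split.
  by move=> x; exact: is_derive1_comp.
move=> x; apply: cvgM; last exact: cg'.
by apply: (@continuous_comp _ _ _ g f'); [exact: cg|exact: cf].
Qed.

Lemma C1_id : C1 (fun x => x).
Proof.
exists (cst 1); split; first by move=> x; exact: is_derive_id.
by move=> x; exact: cvg_cst.
Qed.

Lemma C1_cst (c : R) : C1 (fun=> c).
Proof.
exists (cst 0); split; first by move=> x; exact: is_derive_cst.
by move=> x; exact: cvg_cst.
Qed.

(** In all sign cases the increment differs from its linear part [2 * Num.max 0 x * h] by at most
    h^2, so the difference quotient is within |h| of its limit. *)
Lemma C1_pos_sqr : C1 (fun x => Num.max 0 x ^+ 2).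
Proof.
exists (fun x => 2 * Num.max 0 x); split; last first.
  move=> x; apply: cvgM; first exact: cvg_cst.
  by apply: (@continuous_max R R (cst 0) id x); [exact: cvg_cst|exact: cvg_id].
move=> x; pose q (y : R) := Num.max 0 y ^+ 2.
suff dq : (fun h : R => h^-1 *: (q (h *: 1 + x) - q x)) @ 0^' --> 2 * Num.max 0 x.
  apply: DeriveDef; first by apply/cvg_ex; exists (2 * Num.max 0 x).
  exact: cvg_lim dq.
apply/cvgrPdist_le => e e0; near=> h.
have h0 : h != 0 by near: h; exact: nbhs_dnbhs_neq.
have he : `|h| <= e.
  near: h; apply: nbhs_dnbhs; apply: (cvgr_le _ (@norm_continuous R R 0) e).
  by rewrite normr0.
apply: le_trans he.
have quad : `|2 * Num.max 0 x * h - (q (h + x) - q x)| <= `|h| * `|h|.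
  rewrite -normrM ger0_norm ?sqr_ge0// /q ler_norml.
  by case: (leP 0 x) => hx; case: (leP 0 (h + x)) => hhx; apply/andP; split; nra.
rewrite /GRing.scale /= mulr1 -(ler_pM2r (x := `|h|)) ?normr_gt0// -normrM.
by rewrite mulrBl mulrAC (mulrAC _^-1) mulVf// mul1r; rewrite mulrAC.
Unshelve. all: by end_near.
Qed.

End C1_functions.

(** * A compactly supported approximation of the sign *)

Section test_function.
Context (R : realType) (d : R).
Hypothesis d0 : 0 < d.
Implicit Types x : R.

Let q x : R := Num.max 0 x ^+ 2.

(** The classical smooth transition quotient with squared positive parts in place of exponentials:
    it is 0 for [x <= 0] and 1 for [d <= x]. *)
Definition ramp x : R := q x / (q x + q (d - x)).

Let den_gt0 x : 0 < q x + q (d - x).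
Proof.
(* Twice x^2 + (d - x)^2 is (2x - d)^2 + d^2, which settles the case where [x] and [d - x] are both
   nonnegative. They cannot both be negative, their sum being [d]. *)
have h1 := sqr_ge0 (2 * x - d); have h2 : 0 < d ^+ 2 by rewrite exprn_gt0.
rewrite /q; case: (leP 0 x) => x0; case: (leP 0 (d - x)) => dx.
- nra.
- have xp : 0 < x by rewrite (lt_trans d0)// -subr_lt0.
  have : 0 < x ^+ 2 by rewrite exprn_gt0.
  by rewrite expr0n /= addr0.
- have : 0 < (d - x) ^+ 2 by rewrite exprn_gt0// subr_gt0 (lt_trans x0).
  by rewrite expr0n /= add0r.
- by have := lt_trans x0 d0; rewrite -subr_gt0 ltNge (ltW dx).
Qed.

Lemma ramp_ge0 x : 0 <= ramp x.
Proof. by rewrite divr_ge0 ?sqr_ge0// ltW. Qed.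

Lemma ramp_le1 x : ramp x <= 1.
Proof. by rewrite ler_pdivrMr// mul1r lerDl sqr_ge0. Qed.

Lemma ramp_eq0 x : x <= 0 -> ramp x = 0.
Proof. by move=> x0; rewrite /ramp {1}/q max_l// expr0n /= mul0r. Qed.

Lemma ramp_eq1 x : d <= x -> ramp x = 1.
Proof.
move=> dx; have := den_gt0 x.
have q0 : q (d - x) = 0 by rewrite /q max_l ?subr_le0// expr0n.
by rewrite /ramp q0 addr0 => qx; rewrite divff// gt_eqF.
Qed.

Lemma C1_ramp : C1 ramp.
Proof.
apply: C1M; first exact: C1_pos_sqr.
apply: C1V; first by move=> x; rewrite gt_eqF.
have -> : (fun x => q x + q (d - x)) =
    (fun x => q x - (0 - (fun y => q y) (d - x))).
  by apply/funext => x; rewrite sub0r opprK.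
apply: C1B; first exact: C1_pos_sqr.
apply: C1B; first exact: C1_cst.
apply: (C1_comp (f := q)); first exact: C1_pos_sqr.
by apply: C1B; [exact: C1_cst|exact: C1_id].
Qed.

(** An odd approximate sign times an even cutoff that vanishes for |x| >= 1. *)
Definition sign_approx x : R := (ramp x - ramp (0 - x)) * ramp (1 - x * x).

Lemma C1_sign_approx : C1 sign_approx.
Proof.
apply: C1M.
  apply: C1B; first exact: C1_ramp.
  apply: (C1_comp (f := ramp)); first exact: C1_ramp.
  by apply: C1B; [exact: C1_cst|exact: C1_id].
apply: (C1_comp (f := ramp)); first exact: C1_ramp.
by apply: C1B; [exact: C1_cst|apply: C1M; exact: C1_id].
Qed.

Lemma norm_sign_approx_le x : `|sign_approx x| <= \1_`[-1, 1] x.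
Proof.
rewrite indicE mem_setE in_itv /=; case: (boolP (-1 <= x <= 1)) => x1.
  rewrite /sign_approx normrM mulr_ile1//.
    have := ramp_ge0 x; have := ramp_ge0 (0 - x).
    have := ramp_le1 x; have := ramp_le1 (0 - x).
    by rewrite ler_norml => *; lra.
  by rewrite ger0_norm ?ramp_ge0// ramp_le1.
rewrite /sign_approx (@ramp_eq0 (1 - x * x)) ?mulr0 ?normr0//.
by move: x1; rewrite negb_and -!ltNge => /orP[] x1; nra.
Qed.

Lemma mul_sign_approx_ge0 x : 0 <= sign_approx x * x.
Proof.
rewrite /sign_approx mulrAC mulr_ge0 ?ramp_ge0//.
case: (leP 0 x) => x0.
  have -> : ramp (0 - x) = 0 by apply: ramp_eq0; rewrite sub0r oppr_le0.
  by rewrite subr0 mulr_ge0 ?ramp_ge0.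
rewrite (ramp_eq0 (ltW x0)) sub0r mulNr -mulrN mulr_ge0 ?ramp_ge0//.
by rewrite oppr_ge0 ltW.
Qed.

Lemma mul_sign_approx x : d <= `|x| -> `|x| <= 1 - d -> sign_approx x * x = `|x|.
Proof.
move=> dx x1; rewrite /sign_approx.
(* This puts the argument of the cutoff above [d], where it is 1; it follows from x^2 <= (1 - d)|x|
   <= 1 - d. *)
have xx : x * x <= 1 - d.
  rewrite -expr2 -(real_normK (num_real x)).
  have h1 : 0 <= (1 - d - `|x|) * `|x| by rewrite mulr_ge0// subr_ge0.
  have h2 : 0 <= (1 - `|x|) * (1 - d).
    by rewrite mulr_ge0// subr_ge0; have := d0; have := normr_ge0 x; lra.
  nra.
rewrite (@ramp_eq1 (1 - x * x)) ?mulr1; last lra.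
case: (ger0P x) dx x1 xx => x0 dx x1 xx.
  rewrite (@ramp_eq0 (0 - x)) ?subr0; last lra.
  by rewrite (ramp_eq1 dx) mul1r.
rewrite (@ramp_eq0 x) ?(ltW x0)// (@ramp_eq1 (0 - x)); lra.
Qed.

Lemma C1c_sign_approx : C1c sign_approx.
Proof.
have [f' [df cf']] := C1_sign_approx; split.
- by move=> x; case: (df x).
- have -> : derive1 sign_approx = f'.
    by apply/funext => x; rewrite derive1E; case: (df x).
  exact: cf'.
- apply: (@subclosed_compact _ _ `[-1 : R, 1]%classic).
    exact: closed_closure.
    exact: segment_compact.
  have <- : closure `[-1 : R, 1] = `[-1, 1]%classic.
    by apply/esym/closure_id; exact: interval_closed.
  apply: closure_subset => x /= sx; apply: contraNP sx => xI.
  have := norm_sign_approx_le x; rewrite indicE memNset// normr_le0.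
  by [].
Qed.

End test_function.

(** * The two energy bounds *)

Section variation.
Context (R : realType).
Notation mu := (@lebesgue_measure R).

Lemma half_sqE (x : R) : half_sq R x = 1 / 2 * x ^+ 2.
Proof. by rewrite /half_sq Lfun_valP. Qed.

Lemma half_sq_level0 : half_sq R = level 0 :> (R -> R).
Proof.
apply/funext => x; rewrite half_sqE /level expr0n /= mulr0 max_r//.
by rewrite mulr_ge0 ?sqr_ge0.
Qed.

Lemma integrable_band (a b : R) : 0 <= a ->
  mu.-integrable [set: R] (EFin \o band a b).
Proof.
move=> a0; apply: (@integrable_bounded_support _ _ b b).
  exact: measurable_band.
by move=> x; exact: norm_band_le.
Qed.

(** Testing any [nu] representing Du against [sign_approx] bounds its variation below, and the bound
    passes to the infimum; outside BV the energy is infinite. *)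
Lemma J_half_sq_ge (d : R) : 0 < d -> d < 1 / 2 ->
  ((1 - 2 * d)%:E <= J (half_sq R))%E.
Proof.
move=> d0 d12; rewrite /J; case: ifP => _; last by rewrite leey.
apply: le_ereal_inf_tmp => _ [nu Dnu <-].
pose psi := @sign_approx R d.
have Cpsi : C1c psi by exact: C1c_sign_approx.
have mpsi : measurable_fun [set: R] psi.
  by apply: continuous_measurable_fun; apply: C1_continuous; exact: C1_sign_approx.
have := @charge_integral_le _ _ _ nu `[-1, 1]%classic psi (measurable_itv _) mpsi
  (norm_sign_approx_le d0).
apply: le_trans; rewrite lee_fin (Dnu _ Cpsi) half_sq_level0.
rewrite integral_by_parts_level//.
have -> : 1 - 2 * d = (1 - d) ^+ 2 - d ^+ 2 by ring.
rewrite -integral_norm_band; [|lra|lra].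
(* Pointwise comparison: for d < |x| < 1 - d the tested integrand equals |x|, and elsewhere it is
   nonnegative. *)
apply: le_Rintegral => //.
- exact: integrable_norm (integrable_band (1 - d) (ltW d0)).
- apply: (@integrable_bounded_support _ _ 1 1).
    by apply: measurable_funM => //; exact: measurable_band.
  move=> x; rewrite normrM ler_pM//; last first.
    by rewrite (le_trans (norm_band_le _ _ _))// mul1r.
  apply: (le_trans (norm_sign_approx_le d0 x)).
  by rewrite indicE; case: (_ \in _).
move=> x _; have psix := mul_sign_approx_ge0 d0 x.
rewrite !bandE//; last lra.
case: ifPn => [h|_].
  rewrite ifT; last by move: h => /orP[]/andP[? ?]; apply/orP; lra.
  have [dx x1] : d <= `|x| /\ `|x| <= 1 - d.
    by move: h => /orP[]/andP[h1 h2]; [rewrite ltr0_norm|rewrite gtr0_norm]; lra.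
  by rewrite (mul_sign_approx d0).
by rewrite normr0; case: ifP; rewrite ?mulr0.
Qed.

(** By the integration by parts, the charge of density [band e 1] represents Dv, so its variation,
    at most the integral of |[band e 1]|, bounds the infimum. *)
Lemma J_level_le (e : R) (v : L2 R) : 0 <= e -> e <= 1 ->
  v = level e :> (R -> R) -> (J v <= (1 - e ^+ 2)%:E)%E.
Proof.
move=> e0 e1 vE.
pose nu : {charge set (measurableTypeR R) -> \bar R} :=
  density_charge (integrable_band 1 e0).
have Dnu : is_Du (1 / 2) (1 / 2) v nu.
  move=> phi Cphi; have [M [_ phiM _]] := C1c_support Cphi.
  rewrite vE integral_by_parts_level//.
  apply: (charge_integral_density (integrable_band 1 e0) _ phiM).
  apply: continuous_measurable_fun => x.
  by apply/differentiable_continuous/derivable1_diffP; case: Cphi.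
rewrite /J ifT; last by apply/asboolP; exists nu.
apply: (@le_trans _ _ (total_variation_measure nu `[-1, 1]%classic)).
  by apply: ereal_inf_lbound; exists nu.
apply: (le_trans (total_variation_density _ _)); first exact: measurable_itv.
have inb := integrable_norm (integrable_band 1 e0).
apply: (@le_trans _ _ (\int[mu]_x (`|band e 1 x|)%:E)%E).
  apply: ge0_subset_integral => //.
  by case/integrableP : inb.
rewrite -[leLHS]fineK; last exact: integrable_fin_num.
by rewrite lee_fin -/(Rintegral _ _ _) integral_norm_band// expr1n.
Qed.

End variation.

(** * Square integrability and the inner product estimate *)

Section leb11_facts.
Context (R : realType).

Lemma leb11_setT : @leb11 R [set: _] = 2%:E.
Proof.
rewrite /leb11/= /mrestr setTI lebesgue_measure_itv/= lte_fin.
rewrite (@lt_trans _ _ 0) ?ltrN10// -EFinD; congr EFin; ring.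
Qed.

(** The measure is finite, so essentially bounded functions are in L^2, and the complement of (-1,
    1) is null for it. *)
Lemma bounded_Lfun11 (f : R -> R) : measurable_fun [set: R] f ->
  (forall x, -1 < x -> x < 1 -> `|f x| <= 1) -> f \in Lfun (@leb11 R) 2%:E.
Proof.
move=> mf f1.
have fin : @leb11 R [set: _] \is a fin_num by rewrite leb11_setT.
have ley : (1 <= +oo :> \bar R)%E by rewrite leey.
apply: (Lfun_subset (lee1n 2) ley fin (leey _)).
rewrite inE; apply/andP; split; rewrite inE//= /finite_norm unlock /Lnorm.
case: ifPn => // _.
apply: (@le_lt_trans _ _ 1%E); last exact: ltry.
apply/ess_sup_inf.ess_supP; exists (~` `]-1, 1[%classic); split.
- by apply: measurableC; exact: measurable_itv11.
- by rewrite /leb11/= /mrestr setICl measure0.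
- move=> x /=; apply: contra_not; rewrite /= in_itv/= => /andP[x0 x1].
  by rewrite lee_fin f1.
Qed.

Lemma measurable_level (e : R) : measurable_fun [set: R] (level e).
Proof.
apply: measurable_maxr => //.
by apply: measurable_funM => //; exact: measurable_funX.
Qed.

Lemma level_Lfun (e : R) : 0 <= e -> e <= 1 -> level e \in Lfun (@leb11 R) 2%:E.
Proof.
move=> e0 e1; apply: bounded_Lfun11; first exact: measurable_level.
move=> x x0 x1; rewrite /level.
have : 0 <= e ^+ 2 by exact: sqr_ge0.
have : 0 <= x ^+ 2 by exact: sqr_ge0.
have : e ^+ 2 <= 1 by rewrite expr_le1.
have : x ^+ 2 <= 1.
  by rewrite -real_normK ?num_real// expr_le1// ler_norml !ltW.
by case: (leP (1 / 2 * e ^+ 2)) => ? ? ? ? ?; rewrite ger0_norm; lra.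
Qed.

Lemma level_sub_half_sq (e x : R) : 0 <= e ->
  0 <= level e x - 1 / 2 * x ^+ 2 <= 1 / 2 * e ^+ 2 * \1_`[- e, e] x.
Proof.
move=> e0; rewrite /level indicE mem_setE in_itv /=.
have := sqr_ge0 x; have := sqr_ge0 e.
case: (boolP (- e <= x <= e)) => xe e20 x20.
  by rewrite mulr1; case: (leP (1 / 2 * e ^+ 2)) => ?; apply/andP; split; lra.
have : e ^+ 2 <= x ^+ 2.
  rewrite -(real_normK (num_real x)) ler_sqr ?nnegrE// ler_normr.
  by move: xe; rewrite negb_and -!ltNge => /orP[] /ltW ?;
    apply/orP; [right|left]; lra.
by move=> ?; rewrite max_r; [rewrite mulr0|]; lra.
Qed.

(* AM-GM: [|w| <= (eta w ^ 2 + 1 / eta) / 2], integrated over [-e, e]. *)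
Lemma L2inner_level_ge (w v : L2 R) (e eta : R) :
    0 <= e -> e <= 1 -> 0 < eta -> v = level e :> (R -> R) ->
  - (1 / 4 * e ^+ 2 * (eta * \int[@leb11 R]_x (w x ^+ 2) + eta^-1 * (2 * e))) <=
  L2inner w (v - half_sq R).
Proof.
move=> e0 e1 eta0 vE.
(* The factor 1/2 of AM-GM times the bound e^2/2 on v_e - x^2/2. *)
set c := 1 / 4 * e ^+ 2.
have c0 : 0 <= c by rewrite mulr_ge0 ?sqr_ge0//; lra.
have phiE x : (v - half_sq R) x = level e x - 1 / 2 * x ^+ 2.
  by rewrite -half_sqE -vE.
have i1 : (@leb11 R).-integrable [set: _] (EFin \o (fun x => w x ^+ 2)).
  exact: Lfun2_integrable_sqr (LfunP w).
pose E := `[- e, e]%classic : set R.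
have mE : measurable E by exact: measurable_itv.
have leE : (@leb11 R E <= (2 * e)%:E)%E.
  rewrite /leb11/= /mrestr.
  apply: (@le_trans _ _ (@lebesgue_measure R E)).
    by apply: le_measure; rewrite ?inE//=; exact: measurableI.
  rewrite lebesgue_measure_itv/= lte_fin; case: ifP => _.
    by rewrite -EFinD lee_fin; lra.
  by rewrite lee_fin; lra.
have i2 : (@leb11 R).-integrable [set: _] (EFin \o \1_E).
  apply/integrableP; split; first exact/measurable_EFinP/measurable_indic.
  under eq_integral do rewrite /= ger0_norm//.
  by rewrite integral_indic// setIT (le_lt_trans leE)// ltry.
have i3 : (@leb11 R).-integrable [set: _]
    (EFin \o (fun x => w x * (v - half_sq R) x)).
  exact/Lfun1_integrable/Lfun2_mul_Lfun1/LfunP/LfunP.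
pose k x := - c * (eta * w x ^+ 2 + eta^-1 * \1_E x).
have i4 : (@leb11 R).-integrable [set: _] (EFin \o (fun x => eta * w x ^+ 2)).
  exact: (integrableZl measurableT eta i1).
have i5 : (@leb11 R).-integrable [set: _]
    (EFin \o (fun x => eta^-1 * \1_E x)).
  exact: (integrableZl measurableT eta^-1 i2).
have i6 : (@leb11 R).-integrable [set: _]
    (EFin \o (fun x => eta * w x ^+ 2 + eta^-1 * \1_E x)).
  exact: (integrableD measurableT i4 i5).
apply: (@le_trans _ _ (\int[@leb11 R]_x k x)).
  rewrite /k RintegralZl// RintegralD// !RintegralZl// mulNr lerN2.
  rewrite ler_wpM2l// lerD2l ler_wpM2l ?invr_ge0 ?(ltW eta0)//.
  rewrite /Rintegral integral_indic// setIT -lee_fin fineK//.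
  by rewrite ge0_fin_numE ?measure_ge0// (le_lt_trans leE)// ltry.
apply: le_Rintegral => //; first exact: (integrableZl measurableT (- c) i6).
move=> x _; rewrite phiE; have := level_sub_half_sq x e0.
set p := _ - _; move=> /andP[p0 pe].
(* AM-GM in the form (eta w + 1)^2 / eta >= 0; multiplying by [p >= 0] keeps the direction. *)
have : - (1 / 2 * (eta * w x ^+ 2 + eta^-1)) <= w x.
  have h : 0 <= eta^-1 * (eta * w x + 1) ^+ 2.
    by rewrite mulr_ge0 ?sqr_ge0// invr_ge0 ltW.
  have hE : eta^-1 * (eta * w x + 1) ^+ 2 = eta * w x ^+ 2 + 2 * w x + eta^-1.
    by field; rewrite gt_eqF.
  lra.
move=> wx.
have q0 : 0 <= eta * w x ^+ 2 by rewrite mulr_ge0 ?sqr_ge0// ltW.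
have r0 : 0 < eta^-1 by rewrite invr_gt0.
rewrite /k; move: pe; rewrite -/E indicE; case: (x \in _) => /= pe.
  apply: (@le_trans _ _ (- (1 / 2 * (eta * w x ^+ 2 + eta^-1)) * p)); last first.
    by rewrite ler_wpM2r.
  rewrite mulr1 !mulNr lerN2 /c.
  apply: (@le_trans _ _ (1 / 2 * (eta * w x ^+ 2 + eta^-1) * (1 / 2 * e ^+ 2 * 1))).
    by rewrite ler_wpM2l// mulr_ge0//; lra.
  by rewrite le_eqVlt; apply/orP; left; apply/eqP; field; rewrite gt_eqF.
have -> : p = 0 by move: pe; rewrite mulr0 => pe; apply/eqP; rewrite eq_le pe p0.
by rewrite !mulr0 addr0 mulNr oppr_le0 mulr_ge0.
Qed.

End leb11_facts.

(** * Contradiction from a subgradient *)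

Theorem lemma2p1 (R : realType) : ~ dom_subdifferential (@J R) (half_sq R).
Proof.
move=> [Jfin [w hw]].
pose W := \int[@leb11 R]_x (w x ^+ 2).
have W0 : 0 <= W by apply: Rintegral_ge0 => x _; exact: sqr_ge0.
(* With these choices [eta * W <= 1] and [eta^-1 * (2 * e) = 1], so the bracket in
   [L2inner_level_ge] is at most 2 and the inner product at least -e^2/2. *)
pose eta := (W + 1)^-1; pose e := eta / 2.
have W1 : 0 < W + 1 by lra.
have eta0 : 0 < eta by rewrite invr_gt0.
have etaW : eta * W <= 1 by rewrite mulrC ler_pdivrMr// mul1r lerDl.
have eta1 : eta <= 1 by rewrite invf_le1//; lra.
have e0 : 0 < e by rewrite /e; lra.
have e1 : e <= 1 by rewrite /e; lra.
have ee : eta^-1 * (2 * e) = 1 by rewrite /e; field; rewrite gt_eqF.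
pose v : L2 R := Lfun_Sub (lee1n 2) (level_Lfun (ltW e0) e1).
have vE : v = level e :> (R -> R) by rewrite /v Lfun_valP.
have e20 : 0 < e ^+ 2 by rewrite exprn_gt0.
have e21 : e ^+ 2 <= 1 by rewrite expr_le1//; exact: ltW.
have inner : - (1 / 2 * e ^+ 2) <= L2inner w (v - half_sq R).
  have := L2inner_level_ge w (ltW e0) e1 eta0 vE; rewrite ee -/W.
  apply: le_trans; nra.
have := hw (v - half_sq R); rewrite [half_sq R + _]addrC subrK.
have Jv := J_level_le (ltW e0) e1 vE.
(* Taking [d] to be e^2/8 loses only e^2/4 in the lower bound: the energy drops by at least 3e^2/4,
   while the subgradient allows at most e^2/2. *)
have d0 : 0 < e ^+ 2 / 8 by lra.
have d1 : e ^+ 2 / 8 < 1 / 2 by lra.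
have Jh := J_half_sq_ge d0 d1.
move=> /le_trans /(_ (leeB Jv Jh)).
by rewrite -EFinB lee_fin; lra.
Qed.
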